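(* Let $X$ be an uncountable regular open Whyburn space. The following are equivalent: (1) $X$ satisfies $S_1(\Omega^s,\Omega^s)$; (2) $X$ satisfies $S_1(\mathcal{K}_{\Omega},\mathcal{K}_{\Omega})$; (3) $vet_1(\mathbf{0},Q_p(X,\mathbb{R}))=\omega$; (4) $vet_1(f,Q_p(X,\mathbb{R}))=\omega$ for every continuous $f:X\to\mathbb{R}$; (5) $vet_1(Q_p(X,\mathbb{D}))=\omega$.
   Context: All spaces are assumed regular. A function $f:X\to Y$ is quasicontinuous if for every $x\in X$, every open $V\ni f(x)$ and every open $U\ni x$ there is a nonempty open $W\subseteq U$ with $f(W)\subseteq V$. $Q_p(X,Y)$ is the set of all quasicontinuous functions $X\to Y$ with the topology of pointwise convergence; $\mathbb{D}=\{0,1\}$ is discrete; $\mathbf{0}$ is the constant zero function. $X$ is open Whyburn if for every open $A\subseteq X$ and every $x\in\overline{A}\setminus A$ there is an open $B\subseteq A$ with $\overline{B}\setminus A=\{x\}$. A set $A$ is minimally bounded if $A\subseteq\overline{\mathrm{Int}A}$ and $\mathrm{Int}\overline{A}\subseteq A$. $\Omega^s$ is the collection of covers of $X$ by minimally bounded sets which are $\omega$-covers (every finite subset of $X$ lies in some member). $\mathcal{K}_\Omega$ is the set of families $\mathcal{U}$ of open subsets of $X$ with $X=\bigcup\{\overline{U}:U\in\mathcal{U}\}$, no element of $\mathcal{U}$ dense in $X$, and for each finite $F\subseteq X$ some $U\in\mathcal{U}$ with $F\subseteq\overline{U}$. $S_1(\mathcal{A},\mathcal{B})$: for every sequence $(A_n)_{n\in\mathbb{N}}$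 of elements of $\mathcal{A}$ there are $b_n\in A_n$ with $\{b_n:n\in\mathbb{N}\}\in\mathcal{B}$. For a space $Z$ and $z\in Z$, $vet_1(z,Z)=\omega$ means: for every sequence $(A_n)_{n\in\omega}$ of subsets of $Z$ with $z\in\bigcap_n\overline{A_n}$ there are $a_n\in A_n$ with $z\in\overline{\{a_n:n\in\omega\}}$; $vet_1(Z)=\omega$ means this holds for all $z\in Z$. *)

(* Defs.v *)
From HB Require Import structures.
From mathcomp Require Import all_boot all_order all_algebra.
From mathcomp Require Import all_classical all_reals all_analysis.
Set Implicit Arguments. Unset Strict Implicit. Unset Printing Implicit Defensive.
Import Order.TTheory GRing.Theory Num.Theory.
Local Open Scope classical_set_scope.

Definition quasicontinuous (X Y : topologicalType) (f : X -> Y) : Prop :=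
  forall (x : X) (V : set Y) (U : set X), open V -> V (f x) -> open U -> U x ->
    exists W : set X, [/\ open W, W !=set0, W `<=` U & f @` W `<=` V].

(* Q_p(X,Y), as a subset of the space {ptws X -> Y} of all functions with the
   topology of pointwise convergence (the subspace topology). *)
Definition Qp (X Y : topologicalType) : set {ptws X -> Y} :=
  [set f | quasicontinuous (f : X -> Y)].

(* vet_1(z, Z) = omega, for Z a subspace S of a topological space T and z in S.
   Closures in the subspace S of subsets of S containing z are the traces
   of closures in T, so we use the closure in T. *)
Definition vet1_at (T : topologicalType) (S : set T) (z : T) : Prop :=
  forall A : nat -> set T, (forall n, A n `<=` S) ->
    (forall n, closure (A n) z) ->
    exists a : nat -> T, (forall n, A n (a n)) /\ closure (range a) z.

Definition vet1 (T : topologicalType) (S : set T) : Prop :=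
  forall z, S z -> vet1_at S z.

Definition open_whyburn (X : topologicalType) : Prop :=
  forall (A : set X) (x : X), open A -> closure A x -> ~ A x ->
    exists B : set X, [/\ open B, B `<=` A & closure B `\` A = [set x]].

Definition minimally_bounded (X : topologicalType) (A : set X) : Prop :=
  A `<=` closure (interior A) /\ interior (closure A) `<=` A.

Definition omega_cover (X : topologicalType) (U : set (set X)) : Prop :=
  forall F : set X, finite_set F -> exists2 V, U V & F `<=` V.

Definition Omega_s (X : topologicalType) : set (set (set X)) :=
  [set U | [/\ bigcup U id = setT, (forall V, U V -> minimally_bounded V)
           & omega_cover U]].

Definition K_Omega (X : topologicalType) : set (set (set X)) :=
  [set U | [/\ (forall V, U V -> open V),
              bigcup U closure = setT,
              (forall V, U V -> ~ dense V)
            & forall F : set X, finite_set F -> exists2 V, U V & F `<=` closure V]].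

Definition S1 (X : Type) (A B : set (set (set X))) : Prop :=
  forall U : nat -> set (set X), (forall n, A (U n)) ->
    exists b : nat -> set X, (forall n, U n (b n)) /\ B (range b).
Arguments Qp : clear implicits.

(* Main.v *)
(* The link between functions and open sets is the open Whyburn property: if
   A lies in the closure of its interior, then every finite F in A lies in the
   closure of an open B whose closure is still inside A. Hence the families in
   K_Omega can be made of open sets B whose closure records where a
   quasicontinuous function is close to its target, and conversely closures of
   open sets have quasicontinuous indicators.

   The hard case is (2) => (5) at a discontinuous z : X -> {0,1}, since g and z
   may agree at a boundary point of z without agreeing on any nonempty open set
   near it. Two consequences of S_1(K_Omega, K_Omega) remove the boundary N:
   closed sets without interior are countable, so the n-th family can be
   restricted to functions equal to z on the first n points of N; and the two
   open sets O_0, O_1 on which z is locally constant are countable unions of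
   open sets with closure inside, so there are open W_n containing N such that
   each point off N lies in the closure of only finitely many W_n. Adding W_n
   to the members of the n-th family covers N without spoiling other points. *)
Require Import Defs.
From HB Require Import structures.
From mathcomp Require Import all_boot all_order all_algebra.
From mathcomp Require Import all_classical all_reals all_analysis lra.
Import numFieldNormedType.Exports.
Local Open Scope classical_set_scope.

Set Implicit Arguments. Unset Strict Implicit. Unset Printing Implicit Defensive.
Import Order.TTheory GRing.Theory Num.Theory.

(** * Finite sets and closures for pointwise convergence *)

Lemma finite_setW (T : Type) (Q : set T -> Prop) :
  Q set0 -> (forall x F, Q F -> Q (x |` F)) -> forall F, finite_set F -> Q F.
Proof.
elim/Pchoice: T => T in Q *; move=> Q0 QU F /finite_seqP[s ->].
elim: s => [|x s IHs]; first by rewrite classical_sets.set_nil.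
have -> : [set` (x :: s)] = x |` [set` s]; last exact: QU.
apply/seteqP; split=> y /=; rewrite in_cons.
  by move=> /orP[/eqP|]; [left|right].
by move=> [->|->]; rewrite ?eqxx ?orbT.
Qed.

Lemma closure_ptwsP (X : Type) (Y : topologicalType) (A : set {ptws X -> Y})
    (f : {ptws X -> Y}) :
  closure A f <->
  forall (F : set X) (V : X -> set Y), finite_set F ->
    (forall x, nbhs (f x) (V x)) ->
    exists2 g, A g & forall x, F x -> V x (g x).
Proof.
split=> [clAf F V finF Vf|approx B nB].
  have [] := clAf [set g : {ptws X -> Y} | forall x, F x -> V x (g x)].
    elim/finite_setW: F / finF => [|x F IH].
      by apply: filterS filterT => g _ x [].
    have nx : nbhs f [set g : {ptws X -> Y} | V x (g x)].
      exact: (@proj_continuous {classic X} (fun=> Y) x f (V x) (Vf x)).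
    by apply: filterS (filterI nx IH) => g [/= Vx VF] y [->|/VF].
  by move=> g [Ag Vg]; exists g.
pose D := [set FV : set X * (X -> set Y) |
  finite_set FV.1 /\ forall x, nbhs (f x) (FV.2 x)].
pose E (FV : set X * (X -> set Y)) : set {ptws X -> Y} :=
  [set g | A g /\ forall x, FV.1 x -> FV.2 x (g x)].
have filtE : Filter (filter_from D E).
  apply: filter_from_filter.
    by exists (set0, fun=> setT); split => //= x; exact: filterT.
  move=> [F V] [G W] [/= finF nV] [/= finG nW].
  exists (F `|` G, fun x => V x `&` W x).
    by split=> [|x] /=; [rewrite finite_setU|exact: filterI].
  by move=> g [/= Ag VWg]; split; split=> // x ?; apply VWg; [left|right].
(* Convergence in a supremum topology is tested one coordinate at a time, so members of [E]
   constraining a single point suffice. *)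
have cvgE : filter_from D E --> f.
  apply/cvg_sup => x U [_ [[V oV <-] /= Vfx] VU]; rewrite nbhs_simpl.
  exists ([set x], fun y => [set v | y = x -> V v]) => /=.
    split=> //= y; have [->|yx] := pselect (y = x).
      by apply: filterS (open_nbhs_nbhs (conj oV Vfx)) => v Vv _.
    by apply: filterS filterT => v _ /yx.
  by move=> g [/= _ /(_ x erefl) Vg]; apply/VU/Vg.
have [[F V] [/= finF nV] EB] := cvgE _ nB.
have [g Ag Vg] := approx F V finF nV.
by exists g; split => //; apply: EB.
Qed.

Lemma closure_ptws_boolP (X : Type) (A : set {ptws X -> bool}) (f : X -> bool) :
  closure A f <->
  forall F : set X, finite_set F -> exists2 g, A g & forall x, F x -> g x = f x.
Proof.
split=> [/closure_ptwsP clAf F finF|approx].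
  have [|g Ag gf] := clAf F (fun x => [set f x]) finF; last by exists g.
  exact: (fun x => discrete_set1 (f x)).
apply/closure_ptwsP => F V /approx[g Ag gf] nV; exists g => // x /gf ->.
exact: nbhs_singleton.
Qed.

Lemma closure_ptws_realP (R : realType) (X : Type) (A : set {ptws X -> R})
    (f : X -> R) :
  closure A f <->
  forall (F : set X) (e : R), finite_set F -> (0 < e)%R ->
    exists2 g, A g & forall x, F x -> (`|f x - g x| < e)%R.
Proof.
split=> [/closure_ptwsP clAf F e finF e0|approx].
  by apply: (clAf F (fun x => ball (f x) e)) => // x; exact: nbhsx_ballx.
apply/closure_ptwsP => F V finF nV.
have [e e0 eV] : exists2 e : R, (0 < e)%R & forall x, F x -> ball (f x) e `<=` V x.
  elim/finite_setW: F / finF => [|x F [e e0 IH]].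
    by exists 1%R => // x [].
  have /nbhs_ballP[d /= d0 dV] := nV x.
  exists (Num.min e d); first by rewrite lt_min e0.
  move=> y [->|/IH eV] v; rewrite /ball/= lt_min => /andP[ve vd].
    exact: dV.
  exact: eV.
by have [g Ag gf] := approx F e finF e0; exists g => // x Fx; apply/eV/gf.
Qed.

(** * Semi-open sets under the open Whyburn property *)

Section Regular.
Variable X : topologicalType.
Implicit Types (A B O F : set X) (U : set (set X)).

(** The half of minimal boundedness that preimages of open sets under quasicontinuous maps share. *)
Definition semi_open A := A `<=` closure A°.

Definition closure_omega_cover U :=
  (forall B, U B -> open B) /\
  forall F, finite_set F -> exists2 B, U B & F `<=` closure B.

(** Closure commutes with finite unions, so the local witnesses can be united one point at a
    time. *)
Lemma finite_closure_assembly (Q : set X -> Prop) F :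
  finite_set F -> Q set0 -> (forall B C, Q B -> Q C -> Q (B `|` C)) ->
  (forall x, F x -> exists B, [/\ open B, closure B x & Q B]) ->
  exists B, [/\ open B, F `<=` closure B & Q B].
Proof.
move=> + Q0 QU; elim/finite_setW: F / => [_|x F IH loc].
  by exists set0; split => //; exact: open0.
have [|B [oB FB QB]] := IH; first by move=> y Fy; apply: loc; right.
have [|C [oC Cx QC]] := loc x; first by left.
exists (C `|` B); split; [exact: openU| |exact: QU].
by rewrite closureU => y [->|/FB]; [left|right].
Qed.

Hypothesis regX : regular_space X.

Lemma regular_open_nbhs O x : open O -> O x ->
  exists B, [/\ open B, B x & closure B `<=` O].
Proof.
move=> oO Ox; have [C nC CO] := regX (open_nbhs_nbhs (conj oO Ox)).
exists C°; split; [exact: open_interior|exact: nC|].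
exact: subset_trans (closureS (@interior_subset _ C)) CO.
Qed.

Hypothesis whyburnX : open_whyburn X.

Lemma semi_open_local A x : semi_open A -> A x ->
  exists B, [/\ open B, closure B x & closure B `<=` A].
Proof.
move=> sA Ax; have [Aox|nAox] := pselect (A° x).
  have [B [oB Bx BA]] := regular_open_nbhs (@open_interior _ A) Aox.
  exists B; split=> //; first exact: subset_closure.
  exact: subset_trans BA (@interior_subset _ A).
(* The closure of the Whyburn set leaves [A°] only at [x], which is a point of [A]. *)
have [B [oB BA BD]] := whyburnX (@open_interior _ A) (sA _ Ax) nAox.
have [clBx _] : (closure B `\` A°) x by rewrite BD.
exists B; split=> // y clBy; have [/interior_subset//|nAy] := pselect (A° y).
by have : (closure B `\` A°) y by []; rewrite BD => ->.
Qed.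

Lemma semi_open_finite A F : semi_open A -> finite_set F -> F `<=` A ->
  exists B, [/\ open B, F `<=` closure B & closure B `<=` A].
Proof.
move=> sA finF FA.
apply: (finite_closure_assembly (Q := fun B => closure B `<=` A)) => //.
- by rewrite closure0.
- by move=> B C BA CA; rewrite closureU subUset.
- by move=> x /FA; exact: semi_open_local.
Qed.

(** * Passing to non-dense sets and forcing late indices *)

Hypothesis T1X : accessible_space X.
Hypothesis uncountableX : ~ countable [set: X].

Lemma exists_notin_finite F : finite_set F -> exists x, ~ F x.
Proof.
move=> finF; apply/not_existsP => FT; apply: uncountableX.
apply: (@sub_countable _ _ _ F (subset_card_le _)).
  by move=> x _; apply: contrapT; exact: FT.
exact: finite_set_countable.
Qed.

(** Some [y] lies outside [F] because [X] is infinite; deleting a small closed neighbourhood of [y]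
    from [B] destroys density without affecting [B] near [F]. *)
Lemma not_dense_refine B F : open B -> finite_set F -> F `<=` closure B ->
  exists C, [/\ open C, ~ dense C, C `<=` B & F `<=` closure C].
Proof.
move=> oB finF FB; have [y Fy] := exists_notin_finite finF.
have clF : closed F by exact: (accessible_finite_set_closed.1 T1X).
have [P [oP Py PF]] := regular_open_nbhs (closed_openC clF) Fy.
exists (B `&` ~` closure P); split.
- by apply: openI => //; apply: closed_openC; exact: closed_closure.
- move=> /(_ P); case=> [| |z [Pz [_ /=]]]; [by exists y|exact: oP|].
  by apply; exact: subset_closure.
- exact: subIsetl.
- move=> x Fx C nC; have nP : nbhs x (~` closure P).
    apply: open_nbhs_nbhs; split; last by move=> /PF.
    by apply: closed_openC; exact: closed_closure.
  have [z [Bz [Cz Pz]]] := FB x Fx _ (filterI nC nP).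
  by exists z.
Qed.

(* The hypothesis [~ dense] in [K_Omega] can be dropped by shrinking the
   members, and it yields points that force arbitrarily late indices. *)
Lemma S1_K_Omega_late (V : nat -> set (set X)) :
  S1 (@K_Omega X) (@K_Omega X) -> (forall n, closure_omega_cover (V n)) ->
  exists b : nat -> set X, (forall n, V n (b n)) /\
    forall F m, finite_set F -> exists2 n, (m <= n)%N & F `<=` closure (b n).
Proof.
move=> S1K coverV.
pose W n := [set C : set X | [/\ open C, ~ dense C & exists2 B, V n B & C `<=` B]].
have coverW n F : finite_set F -> exists2 C, W n C & F `<=` closure C.
  move=> finF; have [Vo /(_ F finF)[B VB FB]] := coverV n.
  have [C [oC nC CB FC]] := not_dense_refine (Vo _ VB) finF FB.
  by exists C => //; split => //; exists B.
have [|c [Wc [_ _ _ coverc]]] := S1K W.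
  move=> n; split; [by move=> C []| |by move=> C []|exact: coverW].
  apply/seteqP; split=> // x _.
  by have [C WC xC] := coverW n _ (finite_set1 x); exists C => //; exact: xC.
have /choice[b Vb] n : exists B, V n B /\ c n `<=` B.
  by have [_ _ [B ? ?]] := Wc n; exists B.
(* Non-density leaves a point [p n] outside [closure (c n)]; adding [p i] for all [i < m] to [F]
   excludes the indices below [m]. *)
have /choice[p clp] n : exists x, ~ closure (c n) x.
  have [_ /denseNE[P [[x Px] Pc]] _] := Wc n; exists x => /(_ P) [|z [cz Pz]].
    exact: open_nbhs_nbhs.
  by have : (P `&` c n) z by []; rewrite Pc.
exists b; split=> [n|F m finF]; first exact: (Vb n).1.
have [|_ [n _ <-] Fc] := coverc (F `|` p @` `I_m).
  by rewrite finite_setU; split => //; exact: finite_image.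
exists n; last first.
  by apply: subset_trans (closureS (Vb n).2) => x Fx; apply: Fc; left.
by rewrite leqNgt; apply/negP => nm; apply: (clp n); apply: Fc; right; exists n.
Qed.

(** * The two selection principles *)

Lemma minimally_bounded_closure O : open O -> minimally_bounded (closure O).
Proof.
move=> oO; split.
  by apply: closureS; rewrite -open_subsetE //; exact: subset_closure.
by rewrite -(closure_id _).1; [exact: interior_subset|exact: closed_closure].
Qed.

Lemma S1_Omega_s_K_Omega :
  S1 (@Omega_s X) (@Omega_s X) -> S1 (@K_Omega X) (@K_Omega X).
Proof.
move=> S1O V KV.
have [|c [Vc [covc _ omegac]]] := S1O (fun n => closure @` V n).
  move=> n; have [oV VT _ omegaV] := KV n; split.
  - by rewrite bigcup_image.
  - by move=> _ [B VB <-]; apply: minimally_bounded_closure; exact: oV.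
  - by move=> F /omegaV[B VB FB]; exists (closure B) => //; exists B.
have /choice[b Vb] n : exists B, V n B /\ closure B = c n.
  by have [B VB <-] := Vc n; exists B.
exists b; split=> [n|]; first exact: (Vb n).1.
split.
- by move=> _ [n _ <-]; have [oV _ _ _] := KV n; apply: oV; exact: (Vb n).1.
- apply/seteqP; split=> // x _; have : (bigcup (range c) id) x by rewrite covc.
  move=> [_ [n _ <-] /= cx]; exists (b n); first by exists n.
  by rewrite (Vb n).2.
- by move=> _ [n _ <-]; have [_ _ dV _] := KV n; apply: dV; exact: (Vb n).1.
- move=> F /omegac[_ [n _ <-] Fc]; exists (b n); first by exists n.
  by rewrite (Vb n).2.
Qed.

(** Each cover is refined by open sets whose closures lie in its members; a selection from the
    refinements then enlarges to one from the covers. *)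
Lemma S1_K_Omega_Omega_s :
  S1 (@K_Omega X) (@K_Omega X) -> S1 (@Omega_s X) (@Omega_s X).
Proof.
move=> S1K U OU.
have [|b [Vb coverb]] := @S1_K_Omega_late
    (fun n => [set B | open B /\ exists2 A, U n A & closure B `<=` A]) S1K.
  move=> n; have [_ mbU omegaU] := OU n; split=> [B []//|F finF].
  have [A UA FA] := omegaU F finF.
  have [B [oB FB BA]] := semi_open_finite (mbU _ UA).1 finF FA.
  by exists B => //; split => //; exists A.
have /choice[a Ua] n : exists A, U n A /\ closure (b n) `<=` A.
  by have [_ [A ? ?]] := Vb n; exists A.
have omegaa : omega_cover (range a).
  move=> F finF; have [n _ Fb] := coverb F 0%N finF; exists (a n); first by exists n.
  exact: subset_trans Fb (Ua n).2.
exists a; split=> [n|]; first exact: (Ua n).1.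
split=> //.
  apply/seteqP; split=> // x _; have [A aA xA] := omegaa _ (finite_set1 x).
  by exists A => //; exact: xA.
by move=> _ [n _ <-]; have [_ mbU _] := OU n; apply: mbU; exact: (Ua n).1.
Qed.

(** * From function spaces to selection principles and back *)

Lemma quasicontinuous_semi_open (Y : topologicalType) (f : X -> Y) (V : set Y) :
  quasicontinuous f -> open V -> semi_open (f @^-1` V).
Proof.
move=> qf oV x Vfx C; rewrite nbhsE => -[D [oD Dx] DC].
have [W [oW [y Wy] WD WV]] := qf x V D oV Vfx oD Dx.
exists y; split; last exact/DC/WD.
apply: (filterS (P := W)); last exact: open_nbhs_nbhs.
by move=> w Ww; apply: WV; exists w.
Qed.

(** Each open [B] is coded by the function equal to [a] on [closure B] and to [b] elsewhere. Since
    [V] separates the two values, approximating [a] on [F] within [V] means [F] lies in [closure B].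
    A general [Y] serves both the real and the two-valued case. *)
Lemma vet1_at_cst_S1_K_Omega (Y : topologicalType) (a b : Y) (V : set Y) :
  open V -> V a -> ~ V b ->
  vet1_at (Qp X Y) (fun=> a) -> S1 (@K_Omega X) (@K_Omega X).
Proof.
move=> oV Va nVb vet U KU.
pose step B x := if `[< closure B x >] then a else b.
have [| |h [Uh]] := vet (fun n => step @` U n).
- move=> n _ [B UB <-] x W O oW + oO Ox; rewrite /step.
  case: asboolP => [clBx Wa|nclBx Wb].
    have [y [By Oy]] := clBx O (open_nbhs_nbhs (conj oO Ox)).
    have [oU _ _ _] := KU n.
    exists (O `&` B); split; [exact: openI (oU _ UB)|by exists y|by move=> ? []|].
    move=> _ [w [_ Bw] <-]; rewrite asboolT //; exact: subset_closure.
  exists (O `&` ~` closure B); split; [|by exists x|by move=> ? []|].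
    by apply: openI => //; apply: closed_openC; exact: closed_closure.
  by move=> _ [w [_ Bw] <-]; rewrite asboolF.
- move=> n; apply/closure_ptwsP => F W finF nW.
  have [_ _ _ /(_ F finF)[B UB FB]] := KU n.
  exists (step B); first by exists B.
  move=> x /FB clBx; rewrite /step asboolT //; exact: nbhs_singleton.
move=> /closure_ptwsP clh.
have /choice[c Uc] n : exists B, U n B /\ step B = h n.
  by have [B ? ?] := Uh n; exists B.
have coverc F : finite_set F -> exists2 B, range c B & F `<=` closure B.
  move=> finF; have [|_ [n _ <-] Vh] := clh F (fun=> V) finF.
    by move=> _; exact: open_nbhs_nbhs.
  exists (c n); first by exists n.
  move=> x /Vh; rewrite -(Uc n).2 /step; case: asboolP => // _ /nVb [].
exists c; split=> [n|]; first exact: (Uc n).1.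
split=> //.
- by move=> _ [n _ <-]; have [oU _ _ _] := KU n; apply: oU; exact: (Uc n).1.
- apply/seteqP; split=> // x _; have [B cB xB] := coverc _ (finite_set1 x).
  by exists B => //; exact: xB.
- by move=> _ [n _ <-]; have [_ _ dU _] := KU n; apply: dU; exact: (Uc n).1.
Qed.

Lemma S1_K_Omega_vet1_at0 (R : realType) : S1 (@K_Omega X) (@K_Omega X) ->
  vet1_at (Qp X R) (fun=> 0%R).
Proof.
move=> S1K A qA clA.
pose ball0 n : set R := ball (0%R : R) (n.+1%:R^-1)%R.
have [|b [Vb coverb]] := @S1_K_Omega_late (fun n => [set B | open B /\
    exists2 f : X -> R, A n f & closure B `<=` f @^-1` ball0 n]) S1K.
  move=> n; split=> [B []//|F finF].
  have /closure_ptws_realP/(_ F (n.+1%:R^-1)%R finF) := clA n.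
  case=> [|f Af Ff]; first by rewrite invr_gt0.
  have sf : semi_open (f @^-1` ball0 n).
    by apply: quasicontinuous_semi_open; [exact: qA Af|exact: ball_open].
  have [B [oB FB BA]] := semi_open_finite sf finF Ff.
  by exists B => //; split => //; exists f.
have /choice[f Af] n :
    exists g : X -> R, A n g /\ closure (b n) `<=` g @^-1` ball0 n.
  by have [_ [g ? ?]] := Vb n; exists g.
exists f; split=> [n|]; first exact: (Af n).1.
apply/closure_ptws_realP => F e finF e0.
(* From index [truncn e^-1] on, the tolerance [1/(n+1)] is below [e]. *)
have [n ne Fb] := coverb F (Num.truncn e^-1) finF.
exists (f n); first by exists n.
move=> x /Fb /(Af n).2 /lt_trans; apply.
rewrite invf_plt ?posrE //; apply: lt_le_trans (truncnS_gt _) _.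
by rewrite ler_nat.
Qed.

(** * Countability consequences of the selection principle *)

(** At a point of [N] the Whyburn property gives an open set whose closure meets [N] only there. The
    selected closures therefore cover [N] by countably many finite traces. *)
Lemma closed_no_interior_countable (N : set X) : closed N -> N° = set0 ->
  S1 (@K_Omega X) (@K_Omega X) -> countable N.
Proof.
move=> clN N0 S1K.
have [|b [Vb coverb]] := @S1_K_Omega_late
    (fun n => [set B | open B /\ finite_set (closure B `&` N)]) S1K.
  move=> n; split=> [B []//|F finF].
  have [| |x _|B [oB FB QB]] := finite_closure_assembly
      (Q := fun B => finite_set (closure B `&` N)) finF; last by exists B.
  - by rewrite closure0 set0I.
  - by move=> B C finB finC; rewrite closureU setIUl finite_setU.
  have [Nx|nNx] := pselect (N x); last first.
    have [B [oB Bx BN]] := regular_open_nbhs (closed_openC clN) nNx.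
    exists B; split=> //; first exact: subset_closure.
    by rewrite (_ : _ `&` _ = set0) // -subset0 => y [/BN].
  have [| |B [oB _ BN]] := whyburnX (closed_openC clN) (x := x).
  (* The complement of [N] is dense, so the Whyburn property applies to it at [x]. *)
  - by rewrite closure_setC N0 setC0.
  - by apply.
  move: BN; rewrite setDE setCK => BN; exists B; split=> //.
    by have [] : (closure B `&` N) x by rewrite BN.
  by rewrite BN.
apply: (@sub_countable _ _ _ (\bigcup_n (closure (b n) `&` N)) (subset_card_le _)).
  move=> x Nx; have [n _ xb] := coverb _ 0%N (finite_set1 x).
  by exists n => //; split=> //; exact: xb.
by apply: bigcup_countable => // n _; apply: finite_set_countable; exact: (Vb n).2.
Qed.

(* [P] fills up the closure outside [O], so that [S1] acts on [O] alone. *)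
Lemma open_countable_shrinking O P : open O -> open P -> ~` O `<=` closure P ->
  O `&` P = set0 -> S1 (@K_Omega X) (@K_Omega X) ->
  exists G : nat -> set X,
    (forall n, open (G n) /\ closure (G n) `<=` O) /\ O `<=` \bigcup_n G n.
Proof.
move=> oO oP OP OP0 S1K.
(* An open [G] is interposed because the result asks for open sets, and a point of [closure B] may
   lie outside [B]. *)
pose Q B := exists G : set X, [/\ open G, closure B `<=` G & closure G `<=` O].
have [|b [Vb coverb]] := @S1_K_Omega_late
    (fun n => [set B | open B /\ exists2 C, Q C & B = C `|` P]) S1K.
  move=> n; split=> [B []//|F finF].
  have [| | |x [_ Ox]|B [oB FB QB]] :=
      finite_closure_assembly (Q := Q) (F := F `&` O).
  - exact: finite_setIl.
  - by exists set0; rewrite closure0; split => //; exact: open0.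
  - move=> B C [G [oG BG GO]] [H [oH CH HO]]; exists (G `|` H).
    split; first exact: openU.
      by rewrite closureU; exact: setUSS.
    by rewrite closureU subUset.
  - have [G [oG Gx GO]] := regular_open_nbhs oO Ox.
    have [B [oB Bx BG]] := regular_open_nbhs oG Gx.
    exists B; split=> //; [exact: subset_closure|by exists G].
  exists (B `|` P); first by split; [exact: openU|exists B].
  rewrite closureU => x Fx; have [Ox|/OP] := pselect (O x); last by right.
  by left; apply: FB.
have /choice[G bG] n : exists G : set X,
    [/\ open G, closure (b n) `<=` G `|` closure P & closure G `<=` O].
  have [_ [C [G [oG CG GO]] ->]] := Vb n; exists G; split=> //.
  by rewrite closureU; exact: setUSS.
exists G; split=> [n|x Ox]; first by have [] := bG n.
have [n _ xb] := coverb _ 0%N (finite_set1 x); exists n => //.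
have [_ /(_ x (xb x erefl))[//|clPx] _] := bG n.
have [y [Py Oy]] := clPx O (open_nbhs_nbhs (conj oO Ox)).
by have : (O `&` P) y by []; rewrite OP0.
Qed.

(** * Translation to continuous targets *)

(** Continuity of [f] fixes a neighbourhood of [x] first, and quasicontinuity of [h] then chooses
    [W] inside it, so both functions are controlled on all of [W]. *)
Lemma quasicontinuousB (R : realType) (h f : X -> R) :
  quasicontinuous h -> continuous f -> quasicontinuous (fun x => h x - f x)%R.
Proof.
move=> qh cf x V U oV Vx oU Ux.
have /nbhs_ballP[e /= e0 eV] := open_nbhs_nbhs (conj oV Vx).
have nf : nbhs x (f @^-1` ball (f x) (e / 2)%R).
  by apply: cf; apply: nbhsx_ballx; exact: divr_gt0.
have [||||W [oW W0 WU Wh]] := qh x (ball (h x) (e / 2)%R)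
    (U `&` (f @^-1` ball (f x) (e / 2)%R)°).
- exact: ball_open.
- by apply: ballxx; exact: divr_gt0.
- by apply: openI => //; exact: open_interior.
- by [].
exists W; split=> //; first by move=> y /WU[].
move=> _ [y Wy <-]; apply: eV.
have [_ /interior_subset fy] := WU _ Wy; have hy : ball (h x) (e / 2)%R (h y).
  by apply: Wh; exists y.
move: fy hy; rewrite /ball /= !ltr_norml => /andP[? ?] /andP[? ?].
by apply/andP; split; lra.
Qed.

Lemma vet1_at0_continuous (R : realType) (f : X -> R) :
  vet1_at (Qp X R) (fun=> 0%R) -> continuous f -> vet1_at (Qp X R) f.
Proof.
move=> vet0 cf A qA clA.
pose shift (h : X -> R) x := (h x - f x)%R.
have [| |g [Ag]] := vet0 (fun n => shift @` A n).
- by move=> n _ [h /qA qh <-]; exact: quasicontinuousB.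
- move=> n; apply/closure_ptws_realP => F e finF e0.
  have /closure_ptws_realP/(_ F e finF e0)[h Ah hF] := clA n.
  exists (shift h); first by exists h.
  by move=> x /hF; rewrite /shift sub0r opprB.
move=> /closure_ptws_realP clg.
have /choice[h Ah] n : exists h, A n h /\ shift h = g n.
  by have [h ? ?] := Ag n; exists h.
exists h; split=> [n|]; first exact: (Ah n).1.
apply/closure_ptws_realP => F e finF e0.
have [_ [n _ <-] gF] := clg F e finF e0.
exists (h n); first by exists n.
by move=> x /gF; rewrite -(Ah n).2 /shift sub0r opprB.
Qed.

(** * Two-valued functions with an arbitrary quasicontinuous target *)

Lemma finite_eventually (F : set X) (P : X -> nat -> Prop) : finite_set F ->
  (forall x, F x -> exists m, forall n, (m <= n)%N -> P x n) ->
  exists m, forall n, (m <= n)%N -> forall x, F x -> P x n.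
Proof.
elim/finite_setW: F / => [_|x F IH evP]; first by exists 0%N.
have [|m mP] := IH; first by move=> y Fy; apply: evP; right.
have [|k kP] := evP x; first by left.
exists (maxn m k) => n; rewrite geq_max => /andP[mn kn] y [->|Fy].
  exact: kP.
exact: mP.
Qed.

Lemma S1_K_Omega_vet1_bool :
  S1 (@K_Omega X) (@K_Omega X) -> vet1 (Qp X bool).
Proof.
move=> S1K z qz A qA clA.
pose O c := (z @^-1` [set c])°.
pose N := ~` (O true `|` O false).
have oO c : open (O c) by exact: open_interior.
have zO c x : O c x -> z x = c by move=> /interior_subset.
have sO c : z @^-1` [set c] `<=` closure (O c).
  by apply: quasicontinuous_semi_open => //; exact: discrete_open.
have O0 c : O c `&` O (~~ c) = set0.
  by rewrite -subset0 => x [/zO zx /zO]; rewrite zx; case: c {zx}.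
have OC c : ~` O c `<=` closure (O (~~ c)).
  move=> x nOx; have [/eqP zx|] := eqVneq (z x) (~~ c).
    by apply: sO; apply/eqP.
  (* Now [z x = c] yet [x] is not interior to this fibre, so points with the other value accumulate
     at [x], and [sO] puts points of [O (~~ c)] near them. *)
  move=> zxc D nD.
  have [y [Dy zy]] : exists y, D° y /\ z y = ~~ c.
    apply: contrapT => nz; apply: nOx; apply: filterS (nbhs_interior nD) => y Dy.
    apply: contrapT => zy; apply: nz; exists y; split=> //.
    by move: zy => /=; case: (z y) c {zxc} => -[].
  have [w [Ow Dw]] := sO _ _ zy D Dy.
  by exists w.
have clN : closed N by apply: open_closedC; exact: openU.
have N0 : N° = set0.
  rewrite -subset0 => x Nx.
  have [y [Oy Ny]] := sO (z x) x erefl _ Nx.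
  by apply: Ny; case: (z x) Oy; [left|right].
have /countable_injP[idx idxN] := closed_no_interior_countable clN N0 S1K.
have /choice[G GO] c :=
  open_countable_shrinking (oO c) (oO (~~ c)) (OC c) (O0 c) S1K.
(* The closures of the first [n] shrinkings on both sides are deleted; they stay inside the sets
   [O c], hence [N] survives. *)
pose W n := ~` \bigcup_(i in `I_n) (closure (G true i) `|` closure (G false i)).
have oW n : open (W n).
  apply: closed_openC; apply: closed_bigcup => // i _.
  by apply: closedU; exact: closed_closure.
have NW n : N `<=` W n.
  move=> x Nx [i _ Gx]; apply: Nx.
  case: Gx => Gx; first by left; exact: ((GO true).1 i).2 Gx.
  by right; exact: ((GO false).1 i).2 Gx.
(* As soon as [n] exceeds an [i] with [x] in [G c i], that open set is a neighbourhood of [x]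
   disjoint from [W n]. *)
have evW c x : O c x -> exists m, forall n, (m <= n)%N -> ~ closure (W n) x.
  move=> /(GO c).2[i _ Gx]; exists i.+1 => n ni.
  move=> /(_ _ (open_nbhs_nbhs (conj ((GO c).1 i).1 Gx)))[y [Wy Gy]].
  apply: Wy; exists i => //.
  by case: c {Gx} Gy => Gy; [left|right]; exact: subset_closure.
pose N_ n := N `&` [set x | (idx x < n)%N].
have finN n : finite_set (N_ n).
  rewrite (eq_finite_set (card_esym (inj_card_eq (f := idx) _))).
    by apply: sub_finite_set (finite_II n) => _ [x [_ ?] <-].
  by move=> x y /set_mem[Nx _] /set_mem[Ny _]; apply: idxN; exact: mem_set.
have [|b [Vb coverb]] := @S1_K_Omega_late (fun n => [set B | open B /\
    exists g : X -> bool, [/\ A n g, forall x, N_ n x -> g x = z x &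
      exists2 C, B = C `|` W n & closure C `<=` [set x | g x = z x]]]) S1K.
  move=> n; split=> [B []//|F finF].
  have [|g Ag gz] := (closure_ptws_boolP _ _).1 (clA n) (F `|` N_ n).
    by rewrite finite_setU.
  (* This is the agreement of [g] and [z] off [N]: intersecting the semi-open fibres of [g] with the
     open sets [O c] keeps them semi-open, while agreement at points of [N] may break this. *)
  pose E := (g @^-1` [set true] `&` O true) `|` (g @^-1` [set false] `&` O false).
  have sE : semi_open E.
    have sgO c : g @^-1` [set c] `&` O c `<=` closure (g @^-1` [set c] `&` O c)°.
      move=> x [gx Ox] D nD; rewrite interiorI (interior_id (O c)).1 //.
      have [y [gy [Dy Oy]]] := quasicontinuous_semi_open (qA n g Ag)
        (discrete_open [set c]) gx (filterI nD (open_nbhs_nbhs (conj (oO c) Ox))).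
      by exists y.
    move=> x [/sgO|/sgO]; apply: closureS; apply: interiorS.
      exact: subsetUl.
    exact: subsetUr.
  have [|C [oC FC CE]] :=
      semi_open_finite (F := F `&` ~` N) sE (finite_setIl _ finF).
    move=> x [Fx]; rewrite /N setCK => -[] Ox; [left|right]; split=> //=.
      by rewrite gz ?(zO _ _ Ox) //; left.
    by rewrite gz ?(zO _ _ Ox) //; left.
  exists (C `|` W n).
    split; first exact: openU.
    exists g; split=> //; first by move=> x Nx; apply: gz; right.
    exists C => //; apply: subset_trans CE _.
    by move=> x [[gx /zO zx]|[gx /zO zx]]; rewrite /= gx zx.
  rewrite closureU => x Fx; have [Nx|nNx] := pselect (N x).
    by right; apply: subset_closure; exact: NW.
  by left; apply: FC.
have /choice[g Ag] n : exists g : X -> bool,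
    [/\ A n g, forall x, N_ n x -> g x = z x &
    closure (b n) `<=` [set x | g x = z x] `|` closure (W n)].
  have [_ [g [? ? [C -> Cg]]]] := Vb n; exists g; split=> //.
  by rewrite closureU; exact: setSU.
exists g; split=> [n|]; first by have [] := Ag n.
apply/closure_ptws_boolP => F finF.
(* At late stages the points of [F] in [N] belong to [N_ n], where [g n] was chosen equal to [z];
   the others have left [closure (W n)], so lying in [closure (b n)] forces agreement. *)
have [x _|m mP] := finite_eventually
    (P := fun x n => (N x -> N_ n x) /\ (~ N x -> ~ closure (W n) x)) finF.
  have [Nx|nNx] := pselect (N x).
    by exists (idx x).+1 => n xn; split.
  have [m mW] : exists m, forall n, (m <= n)%N -> ~ closure (W n) x.
    by case: (contrapT nNx); exact: evW.
  by exists m => n mn; split => // _; exact: mW.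
have [n mn Fb] := coverb F m finF.
exists (g n); first by exists n.
move=> x Fx; have [_ gN gb] := Ag n; have [inN outN] := mP n mn x Fx.
have [Nx|/outN nWx] := pselect (N x); first exact/gN/inN.
by have [] := gb _ (Fb x Fx).
Qed.

End Regular.
Theorem theorem4p1 (R : realType) (X : topologicalType) :
  regular_space X -> accessible_space X ->
  ~ countable [set: X] ->
  open_whyburn X ->
  [/\ (S1 (@Omega_s X) (@Omega_s X) <-> S1 (@K_Omega X) (@K_Omega X)),
      (S1 (@K_Omega X) (@K_Omega X) <->
         vet1_at (Qp X R) (fun _ : X => (0%R : R))),
      (vet1_at (Qp X R) (fun _ : X => (0%R : R)) <->
         (forall f : X -> R, continuous f -> vet1_at (Qp X R) f))
    & ((forall f : X -> R, continuous f -> vet1_at (Qp X R) f) <->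
         vet1 (Qp X bool))].
Proof.
move=> regX T1X ncX whyX.
have vet0_S1K : vet1_at (Qp X R) (fun=> 0%R) -> S1 (@K_Omega X) (@K_Omega X).
  apply: (@vet1_at_cst_S1_K_Omega X R 0%R 1%R (ball (0%R : R) 1%R)).
  - exact: ball_open.
  - exact: ballxx.
  - by rewrite /ball /= sub0r normrN normr1 ltxx.
have S1K_vet0 := S1_K_Omega_vet1_at0 regX whyX T1X ncX (R := R).
split.
- by split; [exact: S1_Omega_s_K_Omega|exact: S1_K_Omega_Omega_s].
- by split.
- split=> [vet0 f|]; first exact: vet1_at0_continuous.
  by apply; exact: cst_continuous.
(* Both directions pass through the selection principle for [K_Omega], reached from the zero
   function in one case and from the constant [false] in the other. *)
- split=> [vetf|vetb f]; first apply: S1_K_Omega_vet1_bool => //.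
    by apply/vet0_S1K/vetf; exact: cst_continuous.
  apply: vet1_at0_continuous; apply: S1K_vet0.
  apply: (vet1_at_cst_S1_K_Omega (a := false) (b := true)
    (discrete_open [set false])) => //.
  apply: vetb => x V U _ Vf oU Ux; exists U; split=> //; first by exists x.
  by move=> _ [w _ <-].
Qed.
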